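(* Suppose that for every level $k\ge 1$ there is a classical local level smoother $\mathcal{S}_k^{CG}$, mapping $(A_{CG,k},b_{CG,k},u_{CG,k})$ to an updated iterate in $\mathbb{V}_{CG,k}$, which acts on the interior degrees of freedom $S_k$ and leaves the values on $E_k$ unchanged, such that the cell-wise smoother $\mathcal{S}_k$ satisfies, for every $u_{CG}\in\mathbb{V}_{CG,k}$ and every $\tilde b\in\mathbb{V}_{\mathrm{cell},k}^*$, $$\mathcal{S}_k\bigl(A_k,\tilde b,\mathcal{G}_k u_{CG}\bigr)=\mathcal{G}_k\,\mathcal{S}_k^{CG}\bigl(A_{CG,k},\mathcal{G}_k^T\tilde b,u_{CG}\bigr).$$ For each $k\ge 1$ let $C_{HN}\colon\mathbb{V}_{CG,k}\to\mathbb{V}_{CG,k}$ be a linear operator (hanging-node constraint operator) with $C_{HN}\,\mathcal{P}_{CG,k-1}^{k}v=\mathcal{P}_{CG,k-1}^{k}v$ for all $v\in\mathbb{V}_{CG,k-1}$. Let $\mathrm{MG}_{\mathrm{local}}$ be the cell-wise local V-cycle and $\mathrm{MG}^{CG}_{\mathrm{local}}$ the classical local V-cycle built from $A_{CG,k}$, $\mathcal{S}_k^{CG}$, $\mathcal{P}_{CG,k-1}^k$, $\mathcal{R}_{CG,k}^{k-1}$ and $C_{HN}$ (both defined in the context). Then for every level $\ell$, every $u_{CG,\ell}\in\mathbb{V}_{CG,\ell}$ and every $\tilde b_\ell\in\mathbb{V}_{\mathrm{cell},\ell}^*$ (and arbitrary stored lower-level right-hand sides $\tilde b_k\in\mathbb{V}_{\mathrm{cell},k}^*$,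 $k<\ell$, in the cell-wise cycle, with $\mathcal{G}_k^T\tilde b_k$ stored in the classical cycle, and all stored lower-level iterates zero in both), $$\mathrm{MG}_{\mathrm{local}}\bigl(A_\ell,\tilde b_\ell,\mathcal{G}_\ell u_{CG,\ell},\ell\bigr)=\mathcal{G}_\ell\,\mathrm{MG}^{CG}_{\mathrm{local}}\bigl(A_{CG,\ell},\mathcal{G}_\ell^T\tilde b_\ell,u_{CG,\ell},\ell\bigr).$$ Consequently, the iteration matrix of the cell-wise V-cycle restricted to the subspace $\mathcal{G}_\ell\mathbb{V}_{CG,\ell}\subset\mathbb{V}_{\mathrm{cell},\ell}$ is similar, via $\mathcal{G}_\ell\colon\mathbb{V}_{CG,\ell}\to\mathcal{G}_\ell\mathbb{V}_{CG,\ell}$, to the iteration matrix of $\mathrm{MG}^{CG}_{\mathrm{local}}$; any convergence estimate (spectral bound, or norm bound with the norm transported by $\mathcal{G}_\ell$) that holds for the classical local V-cycle built from $\mathcal{S}_\ell^{CG}$ transfers verbatim to the cell-wise V-cycle.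
   Context: Meshes. $\Omega\subset\mathbb{R}^d$ ($d\in\{2,3\}$) carries a conforming coarse mesh $\mathcal{T}_0$ of quadrilaterals/hexahedra. Cells may be recursively and locally refined, each refinement splitting a parent cell $K$ isotropically into $2^d$ children $K_c$ (bits $b_1,\dots,b_d\in\{0,1\}$ of the child index $c$ give the half of the reference interval in each direction; a child inherits the reference coordinates of its parent, $F_{K_c}(\xi)=F_K((\xi+b)/2)$ on $[0,1]^d$). For $\ell=0,\dots,L$, $\mathcal{T}_\ell$ is the set of all cells of level $\ell$ (further refined or not), a conforming mesh of $\Omega_\ell=\bigcup_{K\in\mathcal{T}_\ell}K$; $\Omega_0=\Omega$. Spaces. Continuous tensor-product elements $\mathbb{Q}_p$ with Gauss–Lobatto nodal basis are used. $\mathbb{V}_{\mathrm{cell},\ell}$ is the broken space of all cell-local coefficient vectors on $\mathcal{T}_\ell$ (one independent set of $(p+1)^d$ nodal values per cell); $\mathbb{V}_{CG,\ell}$ is the space of continuous $\mathbb{Q}_p$ functions on $\mathcal{T}_\ell$ vanishing on $\partial\Omega$, identified with its coefficient vectors; homogeneous Dirichlet DoFs on $\partial\Omega$ are eliminated (their local copies are zero in gathered vectors). The gather $\mathcal{G}_\ell\colon\mathbb{V}_{CG,\ell}\to\mathbb{V}_{\mathrm{cell},\ell}$ replicates each global coefficient into all its cell-local copies; $\mathcal{G}_\ell^T\colon\mathbb{V}_{\mathrm{cell},\ell}^*\to\mathbb{V}_{CG,\ell}^*$ is its transpose (additive assembly). Pairings are Euclidean pairings of coefficient vectors. A cell-wise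 vector is continuous if it lies in $\mathrm{Im}(\mathcal{G}_\ell)$. The DoFs of $\mathbb{V}_{CG,\ell}$ are partitioned into the refinement edge $E_\ell$ (DoFs on $\partial\Omega_\ell\setminus\partial\Omega$) and the interior $S_\ell$ (all others). Operators. $A_\ell\colon\mathbb{V}_{\mathrm{cell},\ell}\to\mathbb{V}_{\mathrm{cell},\ell}^*$ is the linear, cell-by-cell (block-diagonal) operator of element integrals of the bilinear form $\int\nabla u\cdot\nabla v$ (or another symmetric second-order elliptic form), and $A_{CG,\ell}=\mathcal{G}_\ell^TA_\ell\mathcal{G}_\ell$; $A_{CG,0}$ is invertible. Transfers. $\mathcal{P}_{CG,\ell-1}^{\ell}\colon\mathbb{V}_{CG,\ell-1}\to\mathbb{V}_{CG,\ell}$ is the natural embedding $v\mapsto v|_{\Omega_\ell}$ (in coefficients), and $\mathcal{R}_{CG,\ell}^{\ell-1}=(\mathcal{P}_{CG,\ell-1}^{\ell})^T$. With $P_0,P_1$ the 1D matrices that interpolate a degree-$p$ polynomial on $[0,1]$ from its Gauss–Lobatto nodal values to the nodal values on $[0,\frac12]$ and $[\frac12,1]$, the cell-wise prolongation $\mathcal{P}_{\mathrm{cell},\ell-1}^{\ell}\colon\mathbb{V}_{\mathrm{cell},\ell-1}\to\mathbb{V}_{\mathrm{cell},\ell}$ is $(\mathcal{P}_{\mathrm{cell},\ell-1}^{\ell}u)|_{K_c}=\bigl(\bigotimes_{i=1}^dP_{b_i}\bigr)u|_K$ for every child $K_c$ of every refined $K\in\mathcal{T}_{\ell-1}$, and $\mathcal{R}_{\mathrm{cell},\ell}^{\ell-1}=(\mathcal{P}_{\mathrm{cell},\ell-1}^{\ell})^T$.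 Cell-wise local V-cycle $\mathrm{MG}_{\mathrm{local}}(A_\ell,b_\ell,u_\ell,\ell)$ with fixed smoothing counts $\nu_1,\nu_2$. Each lower level $k<\ell$ has a stored right-hand side $b_k$ and a stored iterate $u_k$ (initialized to $0$). If $\ell=0$: return $u_0=A_0^{-1}b_0$, where this coarse solve denotes the continuous solution of the assembled problem, $u_0=\mathcal{G}_0A_{CG,0}^{-1}\mathcal{G}_0^Tb_0$. If $\ell\ge1$: (i) $u_\ell\leftarrow\mathcal{S}_\ell^{\nu_1}(A_\ell,b_\ell,u_\ell)$ ($\nu_1$ successive applications of the cell-wise smoother to the iterate); (ii) $r_\ell\leftarrow b_\ell-A_\ell u_\ell$; (iii) $b_{\ell-1}\leftarrow b_{\ell-1}+\mathcal{R}_{\mathrm{cell},\ell}^{\ell-1}r_\ell$; (iv) $u_{\ell-1}\leftarrow\mathrm{MG}_{\mathrm{local}}(A_{\ell-1},b_{\ell-1},u_{\ell-1},\ell-1)$; (v) $u_\ell\leftarrow u_\ell+\mathcal{P}_{\mathrm{cell},\ell-1}^{\ell}u_{\ell-1}$; (vi) $u_\ell\leftarrow\mathcal{S}_\ell^{\nu_2}(A_\ell,b_\ell,u_\ell)$; return $u_\ell$. Classical local V-cycle $\mathrm{MG}^{CG}_{\mathrm{local}}$: the same recursion on $\mathbb{V}_{CG,\ell}$, with $A_{CG,\ell}$, $\mathcal{S}_\ell^{CG}$, $\mathcal{P}_{CG,\ell-1}^{\ell}$ in place of $A_\ell$, $\mathcal{S}_\ell$, $\mathcal{P}_{\mathrm{cell},\ell-1}^\ell$,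 with step (iii) replaced by $b_{\ell-1}\leftarrow b_{\ell-1}+\mathcal{R}_{CG,\ell}^{\ell-1}C_{HN}^Tr_\ell$, and coarse solve $u_0=A_{CG,0}^{-1}b_0$. The iteration matrix of a V-cycle on level $\ell$ is the linear part of the affine map $u_\ell\mapsto \mathrm{MG}(\cdot,b_\ell,u_\ell,\ell)$ at fixed right-hand sides (defined when the level smoothers are jointly affine in right-hand side and iterate). *)

(* Defs.v *)
From HB Require Import structures.
From mathcomp Require Import all_boot all_order all_algebra all_fingroup.
From mathcomp Require Import complex.
From mathcomp Require Import all_classical all_reals all_analysis.
Set Implicit Arguments.
Unset Strict Implicit.
Unset Printing Implicit Defensive.
Import Order.TTheory GRing.Theory Num.Theory.
Import numFieldNormedType.Exports.
Local Open Scope classical_set_scope.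
Local Open Scope ring_scope.

(** * Coefficient vectors

    A space of coefficient vectors indexed by a finite type [I] is
    [{ffun I -> R^o}]; dual spaces are identified with the spaces themselves
    through the Euclidean pairing, so the transpose of an operator is the
    operator with the transposed matrix. *)

Section Coefficients.
Variable R : realType.

Definition coef (I : finType) : vectType R := {ffun I -> R^o}.

Definition apply_kernel (I J : finType) (m : I -> J -> R) (u : coef J) :
  coef I := [ffun i => \sum_j m i j * u j].

Lemma apply_kernel_linear (I J : finType) (m : I -> J -> R) :
  linear (apply_kernel m).
Proof.
move=> a u v; apply/ffunP => i; rewrite !ffunE scaler_sumr -big_split /=.
apply: eq_bigr => j _; rewrite !ffunE mulrDr; congr (_ + _).
by rewrite /GRing.scale /= mulrCA.
Qed.

HB.instance Definition _ (I J : finType) (m : I -> J -> R) :=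
  GRing.isLinear.Build R (coef J) (coef I) _ (apply_kernel m)
    (apply_kernel_linear m).

(* the operator with matrix [m] *)
Definition op (I J : finType) (m : I -> J -> R) : 'Hom(coef J, coef I) :=
  linfun (apply_kernel m).

Definition unit_coef (I : finType) (i : I) : coef I := [ffun j => (j == i)%:R].

Definition transpose (I J : finType) (f : 'Hom(coef J, coef I)) :
  'Hom(coef I, coef J) := op (fun j i => f (unit_coef j) i).

End Coefficients.

(** * Reference element *)

Section Reference.
Variable R : realType.

(* Rodrigues' formula *)
Definition legendre (p : nat) : {poly R} :=
  ((2 ^ p * p`!)%:R)^-1 *: (('X^2 - 1) ^+ p)^`(p).

(* The p+1 Gauss-Lobatto points on [0,1], in increasing order: the end points
   and the images under t |-> (t+1)/2 of the roots of P_p' in (-1,1). *)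
Definition gauss_lobatto (p : nat) (x : 'I_p.+1 -> R) : Prop :=
  [/\ x ord0 = 0, x ord_max = 1,
      {homo x : i j / (i < j)%N >-> i < j}
    & forall i, i != ord0 -> i != ord_max ->
        root ((legendre p)^`()) (2 * x i - 1)].

Definition lagrange (p : nat) (x : 'I_p.+1 -> R) (i : 'I_p.+1) : {poly R} :=
  \prod_(j | j != i) ((x i - x j)^-1 *: ('X - (x j)%:P)).

(* the one-dimensional matrices P_0 and P_1 *)
Definition prolong1 (p : nat) (x : 'I_p.+1 -> R) (b : bool)
  (i j : 'I_p.+1) : R := (lagrange x j).[(x i + b%:R) / 2].

Variable d : nat.

Definition cube : set 'rV[R]_d := [set xi | forall a, 0 <= xi 0 a <= 1].

(* The face on which coordinate [a] is [b] whenever [s a = Some b], the other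
   coordinates being free. *)
Definition face (s : 'I_d -> option bool) : set 'rV[R]_d :=
  cube `&` [set xi | forall a b, s a = Some b -> xi 0 a = b%:R].

Definition facet (a : 'I_d) (b : bool) : set 'rV[R]_d :=
  cube `&` [set xi | xi 0 a = b%:R].

(* the symmetry of the cube given by a permutation and reflections of the
   coordinates *)
Definition cube_sym (s : 'S_d) (e : 'I_d -> bool) (xi : 'rV[R]_d) : 'rV[R]_d :=
  \row_a (if e a then 1 - xi 0 (s a) else xi 0 (s a)).

(* the bits b_1,...,b_d of a child index *)
Definition bits : finType := {ffun 'I_d -> bool}.

(* the reference coordinates, in its parent, of the point of a child *)
Definition child_point (b : bits) (xi : 'rV[R]_d) : 'rV[R]_d :=
  \row_a ((xi 0 a + (b a)%:R) / 2).

Variables (p : nat) (x : 'I_p.+1 -> R).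

(* indices of the (p+1)^d nodal values of a cell *)
Definition loc : finType := {ffun 'I_d -> 'I_p.+1}.

Definition ref_node (i : loc) : 'rV[R]_d := \row_a x (i a).

Definition shape (i : loc) (xi : 'rV[R]_d) : R :=
  \prod_(a < d) (lagrange x (i a)).[xi 0 a].

Definition ref_grad (f : 'rV[R]_d -> R^o) (xi : 'rV[R]_d) : 'cV[R]_d :=
  \col_a 'D_(delta_mx 0 a) f xi.

End Reference.

(* the integral over [0,1]^n, as an iterated Lebesgue integral *)
Fixpoint cube_integral (R : realType) (n : nat) (f : seq R -> R) : R :=
  match n with
  | 0 => f [::]
  | m.+1 => (\int[@lebesgue_measure R]_(t in `[0%R, 1%R])
              cube_integral m (fun s => f (t :: s)))%R
  end.

Definition point_of (R : realType) (d : nat) (s : seq R) : 'rV[R]_d :=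
  \row_a nth 0 s a.

Definition boundary (T : topologicalType) (A : set T) : set T :=
  closure A `\` interior A.

(** * Meshes *)

Section Cells.
Variables (C : finType) (d : nat).

(* A cell of level [l] is given by its ancestor in the coarse mesh and [l]
   child indices. *)
Fixpoint cell (l : nat) : finType :=
  match l with
  | 0 => C
  | k.+1 => (cell k * bits d)%type
  end.

(* [K] is present if each of its ancestors is refined *)
Fixpoint present (refined : forall l, pred (cell l)) (l : nat) :
    pred (cell l) :=
  match l with
  | 0 => fun _ => true
  | k.+1 => fun K => present refined K.1 && refined k K.1
  end.

Fixpoint cell_map (R : realType) (F : C -> 'rV[R]_d -> 'rV[R]_d) (l : nat) :
    cell l -> 'rV[R]_d -> 'rV[R]_d :=
  match l with
  | 0 => F
  | k.+1 => fun K xi => cell_map F K.1 (child_point K.2 xi)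
  end.

End Cells.

Section Conforming.
Variables (R : realType) (d : nat) (C : finType).
Variable F : C -> 'rV[R]_d -> 'rV[R]_d.

(* C^1 up to the boundary, with invertible Jacobian, and injective *)
Definition regular_map (f : 'rV[R]_d -> 'rV[R]_d) : Prop :=
  {in @cube R d &, injective f} /\
  forall xi, cube xi ->
    [/\ \forall eta \near xi, differentiable f eta,
        {for xi, continuous (fun eta => 'J f eta)}
      & 'J f xi \in unitmx].

(* Two distinct cells which meet do so in a common proper face, on which their
   reference coordinates agree up to a symmetry of the cube. *)
Definition conforming : Prop :=
  forall K K' : C, K != K' -> F K @` @cube R d `&` F K' @` @cube R d !=set0 ->
  exists (s : 'I_d -> option bool) (g : 'S_d) (e : 'I_d -> bool),
    [/\ exists a, s a != None,
        F K @` @cube R d `&` F K' @` @cube R d = F K @` face s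
      & forall xi, face s xi -> F K xi = F K' (cube_sym g e xi)].

Definition covered : set 'rV[R]_d := \bigcup_(K : C) (F K @` @cube R d).

(* the topological boundary of the meshed domain consists of facets of cells *)
Definition boundary_of_facets : Prop :=
  forall y, boundary covered y ->
  exists (K : C) (a : 'I_d) (b : bool),
    (F K @` facet a b) y /\ F K @` facet a b `<=` boundary covered.

End Conforming.

Record mesh (R : realType) (d : nat) := Mesh {
  coarse : finType;
  coarse_map : coarse -> 'rV[R]_d -> 'rV[R]_d;
  coarse_map_regular : forall K, regular_map (coarse_map K);
  coarse_conforming : conforming coarse_map;
  coarse_boundary : boundary_of_facets coarse_map;
  finest : nat;
  refined : forall l, pred (cell coarse d l);
  refined_finest : forall l (K : cell coarse d l), refined K -> (l < finest)%N
}.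

Section MeshLevels.
Variables (R : realType) (d : nat) (M : mesh R d).

Definition Tmesh (l : nat) : finType :=
  {K : cell (coarse M) d l | present (@refined R d M) K}.

Definition Fmap (l : nat) (K : Tmesh l) : 'rV[R]_d -> 'rV[R]_d :=
  cell_map (@coarse_map R d M) (val K).

(* Omega_l *)
Definition region (l : nat) : set 'rV[R]_d := covered (@Fmap l).

(* Omega *)
Definition domain : set 'rV[R]_d := region 0.

(** * Spaces and operators *)

Variables (p : nat) (x : 'I_p.+1 -> R).

Definition Vcell (l : nat) : vectType R := coef R (Tmesh l * loc d p)%type.

Definition node (l : nat) (Ki : Tmesh l * loc d p) : 'rV[R]_d :=
  Fmap Ki.1 (ref_node x Ki.2).

(* The global degrees of freedom are the values at the geometrically distinct
   nodes that do not lie on the boundary of the domain. *)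
Definition dof (l : nat) : finType :=
  seq_sub [seq y <- [seq node Ki | Ki : Tmesh l * loc d p]
          | y \notin boundary domain].

Definition Vcg (l : nat) : vectType R := coef R (dof l).

Definition refinement_edge (l : nat) : set (dof l) :=
  [set y | (boundary (region l) `\` boundary domain) (ssval y)].

Definition gather (l : nat) : 'Hom(Vcg l, Vcell l) :=
  op (fun Ki y => (node Ki == ssval y)%:R).

Definition local_fun (l : nat) (w : Vcell l) (K : Tmesh l) (xi : 'rV[R]_d) :
  R := \sum_(i : loc d p) w (K, i) * shape x i xi.

(* The finite element function with coefficients [u]; on a conforming mesh the
   value at [y] is the same for all cells that contain [y]. *)
Definition fe_fun (l : nat) (u : Vcg l) (y : 'rV[R]_d) : R :=
  xget 0 [set r | exists (K : Tmesh l) (xi : 'rV[R]_d),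
    [/\ cube xi, Fmap K xi = y & r = local_fun (gather l u) K xi]].

(* The natural embedding: coefficients are point values at the nodes, and the
   columns of the matrix are the images of the nodal basis functions. *)
Definition prolong_cg (l : nat) : 'Hom(Vcg l, Vcg l.+1) :=
  op (fun (y : dof l.+1) (z : dof l) => fe_fun (unit_coef R z) (ssval y)).

Definition restrict_cg (l : nat) : 'Hom(Vcg l.+1, Vcg l) :=
  transpose (prolong_cg l).

Definition prolong_cell (l : nat) : 'Hom(Vcell l, Vcell l.+1) :=
  op (fun (Ki : Tmesh l.+1 * loc d p) (Kj : Tmesh l * loc d p) =>
    if (val Ki.1).1 == val Kj.1 then
      \prod_(a < d) prolong1 x ((val Ki.1).2 a) (Ki.2 a) (Kj.2 a)
    else 0).

Definition restrict_cell (l : nat) : 'Hom(Vcell l.+1, Vcell l) :=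
  transpose (prolong_cell l).

End MeshLevels.

(** * Elliptic forms

    a(u,v) = \int D grad u . grad v + (beta . grad u) v + u (beta . grad v)
             + c u v
    with bounded measurable coefficients and D symmetric, uniformly positive
    definite; the Laplacian is D = 1, beta = 0, c = 0. *)

Definition bounded_measurable (R : realType) (d : nat) (Om : set 'rV[R]_d)
    (f : 'rV[R]_d -> R) : Prop :=
  let pt (t : d.-tuple (measurableTypeR R)) := \row_a (tnth t a : R) in
  measurable_fun (pt @^-1` Om) (fun t => f (pt t) : measurableTypeR R) /\
  exists B, forall y, Om y -> `|f y| <= B.

Record elliptic_form (R : realType) (d : nat) (Om : set 'rV[R]_d) :=
EllipticForm {
  diffusion : 'rV[R]_d -> 'M[R]_d;
  drift : 'rV[R]_d -> 'cV[R]_d;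
  reaction : 'rV[R]_d -> R;
  diffusion_bm : forall a b, bounded_measurable Om (fun y => diffusion y a b);
  drift_bm : forall a, bounded_measurable Om (fun y => drift y a 0);
  reaction_bm : bounded_measurable Om reaction;
  diffusion_sym : forall y, Om y -> (diffusion y)^T = diffusion y;
  diffusion_elliptic : exists2 alpha : R, 0 < alpha & forall y, Om y ->
    forall z : 'cV[R]_d,
      alpha * (z^T *m z) 0 0 <= (z^T *m diffusion y *m z) 0 0
}.

Section Discretization.
Variables (R : realType) (d : nat) (M : mesh R d).
Variables (p : nat) (x : 'I_p.+1 -> R).
Variable a : elliptic_form (domain M).

(* The form applied to the functions u o F^-1 and v o F^-1 on the cell
   F([0,1]^d), transformed to the reference cell; ['J F] is the transpose of
   the usual Jacobian matrix. *)
Definition element_integral (F : 'rV[R]_d -> 'rV[R]_d)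
    (u v : 'rV[R]_d -> R) : R :=
  cube_integral d (fun s =>
    let xi := point_of d s in
    let y := F xi in
    let gu := invmx ('J F xi) *m ref_grad u xi in
    let gv := invmx ('J F xi) *m ref_grad v xi in
    ((gv^T *m diffusion a y *m gu) 0 0
     + ((drift a y)^T *m gu) 0 0 * v xi + u xi * ((drift a y)^T *m gv) 0 0
     + reaction a y * u xi * v xi) * `|\det ('J F xi)|).

Definition Acell (l : nat) : 'End(Vcell M p l) :=
  op (fun (Ki Kj : Tmesh M l * loc d p) =>
    if Ki.1 == Kj.1 then
      element_integral (Fmap Ki.1) (shape x Kj.2) (shape x Ki.2)
    else 0).

Definition Acg (l : nat) : 'End(Vcg M x l) :=
  (transpose (gather M x l) \o Acell l \o gather M x l)%VF.

Definition coarse_cell : 'End(Vcell M p 0) :=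
  (gather M x 0 \o (Acg 0)^-1 \o transpose (gather M x 0))%VF.

Definition coarse_cg : 'End(Vcg M x 0) := (Acg 0)^-1%VF.

End Discretization.

(** * The local V-cycle *)

Section VCycle.
Variables (R : realType) (V : nat -> vectType R).
Variables (A : forall k, 'End(V k)) (coarse_solve : 'End(V 0)).
(* [S k A b u] is the smoothed iterate *)
Variable S : forall k, 'End(V k) -> V k -> V k -> V k.
Variables (Res : forall k, 'Hom(V k.+1, V k)).
Variables (Pro : forall k, 'Hom(V k, V k.+1)).
Variables (nu1 nu2 : nat).

(* [bs] and [us] are the right-hand sides and iterates stored on the lower
   levels, each of which is visited once *)
Fixpoint vcycle (bs us : forall k, V k) (l : nat) : V l -> V l -> V l :=
  match l with
  | 0 => fun b _ => coarse_solve b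
  | k.+1 => fun b u =>
      let u1 := iter nu1 (S (A k.+1) b) u in
      let r := b - A k.+1 u1 in
      let b' := bs k + Res k r in
      let u' := vcycle bs us b' (us k) in
      let u2 := u1 + Pro k u' in
      iter nu2 (S (A k.+1) b) u2
  end.

End VCycle.

Section LocalMultigrid.
Variables (R : realType) (d : nat) (M : mesh R d).
Variables (p : nat) (x : 'I_p.+1 -> R).
Variable a : elliptic_form (domain M).
Variables (nu1 nu2 : nat).

(* stored lower-level iterates are zero *)
Definition mg_local
    (S : forall k, 'End(Vcell M p k) -> Vcell M p k -> Vcell M p k ->
         Vcell M p k)
    (bs : forall k, Vcell M p k) (l : nat) :
    Vcell M p l -> Vcell M p l -> Vcell M p l :=
  vcycle (Acell x a) (coarse_cell x a) S
    (restrict_cell M x) (prolong_cell M x) nu1 nu2 bs (fun=> 0) (l := l).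

Definition mg_local_cg
    (S : forall k, 'End(Vcg M x k) -> Vcg M x k -> Vcg M x k -> Vcg M x k)
    (CHN : forall k, 'End(Vcg M x k))
    (bs : forall k, Vcg M x k) (l : nat) :
    Vcg M x l -> Vcg M x l -> Vcg M x l :=
  vcycle (Acg x a) (coarse_cg x a) S
    (fun k => restrict_cg M x k \o transpose (CHN k.+1))%VF
    (prolong_cg M x) nu1 nu2 bs (fun=> 0) (l := l).

End LocalMultigrid.

(** * Iteration matrices *)

Section Iteration.
Variable R : realType.

Definition jointly_affine (V : vectType R) (f : V -> V -> V) : Prop :=
  exists (m n : 'End(V)) (c : V), forall b u, f b u = m u + n b + c.

(* the linear part of an affine map *)
Definition iteration (V : vectType R) (f : V -> V) : 'End(V) :=
  linfun (fun u => f u - f 0).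

Definition restriction (V : vectType R) (W : {vspace V}) (f : 'End(V)) :
  'End(subvs_of W) := linfun (vsproj W \o f \o vsval).

Definition corestriction (U V : vectType R) (g : 'Hom(U, V)) :
  'Hom(U, subvs_of (limg g)) := linfun (vsproj (limg g) \o g).

(* [f1] and [f2] are similar via the isomorphism [g] *)
Definition similar_via (U V : vectType R) (g : 'Hom(U, V))
    (f1 : 'End(U)) (f2 : 'End(V)) : Prop :=
  [/\ lker g == 0%VS, limg g == fullv & f2 = (g \o f1 \o g^-1)%VF].

(* the complex eigenvalues *)
Definition spectrum (V : vectType R) (f : 'End(V)) : set R[i] :=
  [set z | root (map_poly (real_complex R)
                   (char_poly (passmx.mxof (vbasis fullv) (vbasis fullv) f))) z].

Definition spectral_bound (V : vectType R) (f : 'End(V)) (rho : R) : Prop :=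
  forall z, spectrum f z -> `|z| <= real_complex R rho.

Definition is_norm (V : vectType R) (N : V -> R) : Prop :=
  [/\ forall v, N v = 0 -> v = 0,
      forall c v, N (c *: v) = `|c| * N v
    & forall v w, N (v + w) <= N v + N w].

(* a bound for n steps of the iteration *)
Definition norm_bound (V : vectType R) (N : V -> R) (f : 'End(V)) (n : nat)
  (rho : R) : Prop := forall v, N (iter n f v) <= rho * N v.

End Iteration.

(* Main.v *)
(* The crux is that cell-wise prolongation commutes with gathering: the parent
   polynomial, evaluated at a node of a child, must not depend on the cell that
   contains the node, and must vanish on the Dirichlet boundary.  A shape
   function that does not vanish at a point belongs to a node of the minimal face
   of the cube containing that point.  If two cells of a level share a point,
   conformity of the coarse mesh provides, by induction on the level, a symmetry
   of the cube that identifies them on the minimal faces of that point; since the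
   Gauss-Lobatto nodes are symmetric, it permutes the nodes and the shape
   functions.  Transposing, the assembled cell-wise restriction is the classical
   restriction of the assembled residual, and C_HN^T is absorbed because C_HN
   fixes the image of the prolongation.  The V-cycles then correspond by induction
   on the level, hence so do their linear parts. *)

Require Import Defs.
From mathcomp Require Import all_boot all_order all_algebra all_fingroup.
From mathcomp Require Import complex.
From mathcomp Require Import all_classical all_reals all_analysis.
From mathcomp Require Import ring lra.
From mathcomp Require polyorder.
Import Order.TTheory GRing.Theory Num.Theory.
Import numFieldNormedType.Exports.
Local Open Scope classical_set_scope.
Local Open Scope ring_scope.

Set Implicit Arguments.
Unset Strict Implicit.
Unset Printing Implicit Defensive.

(** * Gauss-Lobatto nodes and Lagrange polynomials *)

Lemma derivn_comp_oppX (R : comNzRingType) (q : {poly R}) n :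
  (q \Po - 'X)^`(n) = (-1) ^+ n *: (q^`(n) \Po - 'X).
Proof.
elim: n => [|n IHn]; first by rewrite !derivn0 expr0 scale1r.
rewrite !derivnS IHn derivZ deriv_comp derivN derivX mulrN mulr1.
by rewrite exprS mulN1r scaleNr scalerN.
Qed.

(** The power [('X^2 - 1) ^+ p] is even, and each of the [p] derivatives contributes a sign. *)
Lemma legendre_comp_oppX (R : realType) p :
  legendre R p \Po - 'X = (-1) ^+ p *: legendre R p.
Proof.
rewrite /legendre linearZ /= scalerA mulrC -scalerA; congr (_ *: _).
have: ('X ^+ 2 - 1 : {poly R}) ^+ p \Po - 'X = ('X ^+ 2 - 1) ^+ p.
  by rewrite rmorphXn rmorphB rmorphXn /= comp_polyX sqrrN rmorph1.
move=> /(congr1 (derivn p)); rewrite derivn_comp_oppX => h; rewrite -[in RHS]h.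
by rewrite scalerA -exprMn mulrNN mulr1 expr1n scale1r.
Qed.

Lemma root_deriv_legendreN (R : realType) p (t : R) :
  root (legendre R p)^`() t -> root (legendre R p)^`() (- t).
Proof.
move=> /rootP h.
have /(congr1 (horner^~ t)) := congr1 (@deriv _) (legendre_comp_oppX R p).
rewrite derivZ deriv_comp derivN derivX mulrN mulr1 !hornerE horner_comp !hornerE.
by rewrite h mulr0 => /eqP; rewrite oppr_eq0 => /eqP ?; apply/rootP.
Qed.

(** The power [('X^2 - 1) ^+ p] has degree [2p], and in characteristic zero each of the [p + 1]
    derivatives taken in all lowers the degree by exactly one. *)
Lemma size_deriv_legendre (R : realType) p : size (legendre R p)^`() = p.
Proof.
rewrite /legendre derivZ size_scale; last first.
  by rewrite invr_eq0 pnatr_eq0 muln_eq0 expn_eq0 -lt0n fact_gt0.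
rewrite -derivnS.
have sz n (q : {poly R}) : size q^`(n) = (size q - n)%N.
  elim: n => [|n IHn]; first by rewrite derivn0 subn0.
  by rewrite derivnS polyorder.size_deriv IHn subnS.
rewrite sz.
have := size_exp ('X ^+ 2 - 1 : {poly R}) p; rewrite size_XnsubC //= => h.
have nz : ('X ^+ 2 - 1 : {poly R}) ^+ p != 0.
  by rewrite expf_neq0 // -size_poly_gt0 size_XnsubC.
rewrite -(ltn_predK (_ : 0 < size _)%N) ?size_poly_gt0 // h subSS.
by rewrite mul2n -addnn addnK.
Qed.

Lemma inj_nodes (R : realType) p (x : 'I_p.+1 -> R) :
  gauss_lobatto x -> injective x.
Proof.
case=> _ _ mx _ i j; case: (ltngtP i j) => [/mx|/mx|/val_inj] //.
  by move=> + e; rewrite e ltxx.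
by move=> + e; rewrite e ltxx.
Qed.

(* The reflections of the interior nodes are roots of the same polynomial, which
   is even or odd; a new one would give it more roots than its degree. *)
Lemma gauss_lobatto_sym (R : realType) p (x : 'I_p.+1 -> R) :
  gauss_lobatto x -> forall i, exists j, x j = 1 - x i.
Proof.
move=> hx i; have ix := inj_nodes hx; case: hx => x0 x1 mx rx.
have [->|i0] := eqVneq i ord0; first by exists ord_max; rewrite x0 x1 subr0.
have [->|i1] := eqVneq i ord_max; first by exists ord0; rewrite x0 x1 subrr.
pose I := enum [pred j : 'I_p.+1 | (j != ord0) && (j != ord_max)].
pose s := [seq 2 * x j - 1 | j <- I].
(* [1 - 2 * x i] is the image of [1 - x i] under [t |-> 2t - 1]; if it already occurs in [s], its
   node is the reflection sought. *)
have [|/negP ns] := boolP (1 - 2 * x i \in s).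
  by case/mapP => j _ e; exists j; lra.
have pgt : (0 < p)%N.
  by apply: leq_trans (leq_ord i); rewrite lt0n; exact: i0.
(* The two excluded indices differ because [0 < p], which leaves [p - 1] interior nodes. *)
have szI : (size I = p.-1)%N.
  rewrite -cardE; set P := mem _; have := cardC P; rewrite card_ord.
  have /eq_card -> : [predC P] =i pred2 ord0 ord_max.
    by move=> j; rewrite !inE /= negb_and !negbK.
  rewrite card2.
  by rewrite -(inj_eq val_inj) /= eq_sym -lt0n pgt addn2; move: #|P| => m [<-].
have : (size ((1 - 2 * x i)%R :: s) < size (legendre R p)^`())%N.
  apply: max_poly_roots.
  - by rewrite -size_poly_gt0 size_deriv_legendre.
  - rewrite /= -opprB root_deriv_legendreN ?rx //; apply/allP => _ /mapP[j + ->].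
    by rewrite mem_enum => /andP[? ?]; apply: rx.
  - rewrite /=; apply/andP; split; first exact/negP.
    rewrite map_inj_uniq ?enum_uniq // => j k e; apply: ix; lra.
by rewrite size_deriv_legendre /= size_map szI prednK // ltnn.
Qed.

Section Lagrange.
Variables (R : realType) (p : nat) (x : 'I_p.+1 -> R).

Lemma horner_lagrange i t :
  (Defs.lagrange x i).[t] = \prod_(j | j != i) ((x i - x j)^-1 * (t - x j)).
Proof.
by rewrite /Defs.lagrange horner_prod; apply: eq_bigr => j _; rewrite !hornerE.
Qed.

Lemma lagrange_node i k :
  injective x -> (Defs.lagrange x i).[x k] = (i == k)%:R.
Proof.
move=> ix; rewrite horner_lagrange; case: (eqVneq i k) => [->|ik].
  by apply: big1 => j jk; rewrite mulVf // subr_eq0 (inj_eq ix) eq_sym.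
by rewrite (bigD1 k) 1?eq_sym //= subrr mulr0 mul0r.
Qed.

(** The reflection permutes the nodes and changes the sign of both numerator and denominator in
    every factor of the product. *)
Lemma lagrange_flip (f : 'I_p.+1 -> 'I_p.+1) i t :
  injective x -> (forall j, x (f j) = 1 - x j) ->
  (Defs.lagrange x (f i)).[1 - t] = (Defs.lagrange x i).[t].
Proof.
move=> ix fx.
have ff : involutive f by move=> j; apply: ix; rewrite !fx; ring.
rewrite !horner_lagrange (reindex_inj (inv_inj ff)) /=.
apply: eq_big => [j|j _]; first by rewrite (inj_eq (inv_inj ff)).
rewrite !fx -(opprB (x j) t) -(opprB (x j) (x i)) invrN mulrNN.
by congr (_^-1 * _); ring.
Qed.

End Lagrange.

(** * Cells sharing a point *)

Section MinimalFace.
Variables (R : realType) (d : nat).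
Implicit Types (xi eta : 'rV[R]_d) (b : bits d).

(* [eta] belongs to the smallest closed face of the cube that contains [xi] *)
Definition in_min_face xi eta : Prop :=
  cube eta /\ forall a (b : bool), xi 0 a = b%:R -> eta 0 a = b%:R.

Lemma cube_child_point b xi : cube xi -> cube (child_point b xi).
Proof.
move=> h a; rewrite !mxE; have := h a.
by case: (b a) => /= /andP[? ?]; apply/andP; split; lra.
Qed.

(** For [t] in [0,1], [(t + b) / 2] can be 0 or 1 only if [t] is at the same end, so the child point
    lies on no face that [xi] does not lie on. *)
Lemma in_min_face_child b xi eta : cube xi -> in_min_face xi eta ->
  in_min_face (child_point b xi) (child_point b eta).
Proof.
move=> cx [ce h]; split; first exact: cube_child_point.
move=> a c; rewrite !mxE => e; have /andP[h0 h1] := cx a.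
have := h a c; suff -> : xi 0 a = c%:R.
  by move=> /(_ erefl) ->; case: c (b a) e => -[] /=; lra.
by case: c (b a) e => -[] /=; lra.
Qed.

Lemma cube_cube_sym (g : 'S_d) e xi : cube xi -> cube (cube_sym g e xi).
Proof.
move=> h a; rewrite mxE; have /andP[? ?] := h (g a).
by case: (e a); apply/andP; split; lra.
Qed.

End MinimalFace.

(** * Symmetries matching cells on minimal faces, and boundary faces *)

Section Conformity.
Variables (R : realType) (d : nat) (C : finType).
Variable F : C -> 'rV[R]_d -> 'rV[R]_d.
Hypothesis F_regular : forall K, regular_map (F K).
Hypothesis F_conforming : conforming F.

Let F_inj K : {in @cube R d &, injective (F K)}.
Proof. by have [] := F_regular K. Qed.

(** Within one cell, injectivity gives the identity. For distinct cells the common face contains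
    [xi], hence its whole minimal face, and conformity supplies the symmetry there. *)
Lemma coarse_face_match (K K' : C) (xi xi' : 'rV[R]_d) :
  cube xi -> cube xi' -> F K xi = F K' xi' ->
  exists (g : 'S_d) (e : 'I_d -> bool), xi' = cube_sym g e xi /\
    forall eta, in_min_face xi eta -> F K eta = F K' (cube_sym g e eta).
Proof.
move=> cx cx' eF; have [eK|neK] := eqVneq K K'.
  have sym1 eta : cube_sym 1%g (fun=> false) eta = eta :> 'rV[R]_d.
    by apply/rowP => a; rewrite mxE perm1.
  exists 1%g, (fun=> false); split; last by move=> eta _; rewrite sym1 eK.
  by rewrite sym1; apply/esym/(@F_inj K); rewrite ?inE // eF eK.
have [|s [g [e [_ eI eqs]]]] := F_conforming neK.
  by exists (F K xi); split; [exists xi|rewrite eF; exists xi'].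
have [z fz ez] : (F K @` face s) (F K xi).
  by rewrite -eI; split; [exists xi|rewrite eF; exists xi'].
(* Conformity only gives some point of the face with the same image; injectivity identifies it with
   [xi]. *)
have {z fz ez} fx : face s xi.
  by rewrite -(F_inj _ _ ez) // inE //; case: fz.
exists g, e; split.
  apply: (@F_inj K'); rewrite ?inE //; first exact: cube_cube_sym.
  by rewrite -eF eqs.
move=> eta [ce h]; apply: eqs; split=> // a b sab.
by apply: h; case: fx => _; apply.
Qed.

(** Induction on the level, matching the parents at the positions of the two points. The permutation
    is inherited; whether a coordinate is reflected depends only on the two child bits. *)
Lemma face_match (l : nat) (K K' : cell C d l) (xi xi' : 'rV[R]_d) :
  cube xi -> cube xi' -> cell_map F K xi = cell_map F K' xi' ->
  exists (g : 'S_d) (e : 'I_d -> bool), xi' = cube_sym g e xi /\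
    forall eta, in_min_face xi eta ->
      cell_map F K eta = cell_map F K' (cube_sym g e eta).
Proof.
elim: l K K' xi xi' => [|l IH]; first exact: coarse_face_match.
move=> [K b] [K' b'] xi xi' cx cx' /= eF.
have [g [e [exi' match_]]] :=
  IH _ _ _ _ (cube_child_point b cx) (cube_child_point b' cx') eF.
have xi'E a : (xi' 0 a + (b' a)%:R) / 2 =
    if e a then 1 - (xi 0 (g a) + (b (g a))%:R) / 2
    else (xi 0 (g a) + (b (g a))%:R) / 2.
  by have := congr1 (fun m : 'rV_d => m 0 a) exi'; rewrite !mxE.
(* In each coordinate the cells coincide, are mirror images, or touch; in the
   last case the coordinate is 0 or 1 throughout the minimal face. *)
exists g, (fun a => b (g a) (+) b' a); split.
  apply/rowP => a; rewrite mxE; have := xi'E a.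
  have /andP[? ?] := cx (g a); have /andP[? ?] := cx' a.
  by case: (e a); case: (b (g a)); case: (b' a) => /=; lra.
move=> eta min_eta; rewrite match_; last exact: in_min_face_child.
congr (cell_map _ _ _); apply/rowP => a; rewrite !mxE.
have /andP[? ?] := cx (g a); have /andP[? ?] := cx' a.
case: min_eta => _ h; have := xi'E a.
have := h (g a) true; have := h (g a) false.
case: (e a); case: (b (g a)); case: (b' a) => /= h0 h1 eqn; lra.
Qed.

Hypothesis F_boundary : boundary_of_facets F.

(** The boundary point lies on a boundary facet of some cell [K']; the symmetry matching [K] with
    [K'] carries the minimal face of [xi] into that facet. *)
Lemma coarse_boundary_face (K : C) (xi eta : 'rV[R]_d) :
  cube xi -> in_min_face xi eta ->
  boundary (covered F) (F K xi) -> boundary (covered F) (F K eta).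
Proof.
move=> cx min_eta /F_boundary[K' [a [b [[z [cz za] ez] sub]]]].
have [g [e [ez' ->]]] := coarse_face_match cx cz (esym ez); last by [].
apply: sub; exists (cube_sym g e eta) => //; split.
  by apply: cube_cube_sym; case: min_eta.
case: min_eta => _ h; move: za; rewrite ez' /= !mxE.
case: (e a) => [za|]; last exact: h.
rewrite (h (g a) (~~ b)); last by case: (b) za => /=; lra.
by case: (b) => /=; lra.
Qed.

Lemma boundary_face (l : nat) (K : cell C d l) (xi eta : 'rV[R]_d) :
  cube xi -> in_min_face xi eta ->
  boundary (covered F) (cell_map F K xi) ->
  boundary (covered F) (cell_map F K eta).
Proof.
elim: l K xi eta => [|l IH] K xi eta cx min_eta.
  exact: coarse_boundary_face.
by apply: IH; [exact: cube_child_point|exact: in_min_face_child].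
Qed.

End Conformity.

(** * Transfer operators *)

Section Coefficients.
Variable R : realType.

Lemma opE (I J : finType) (m : I -> J -> R) (u : coef R J) i :
  op m u i = \sum_j m i j * u j.
Proof. by rewrite lfunE /= ffunE. Qed.

Lemma sum_unit_coef (I : finType) (F : I -> R) i :
  \sum_j F j * unit_coef R i j = F i.
Proof.
rewrite (bigD1 i) //= ffunE eqxx mulr1 big1 ?addr0 // => j /negbTE ji.
by rewrite ffunE ji mulr0.
Qed.

Lemma coef_sum (I : finType) (u : coef R I) : u = \sum_i u i *: unit_coef R i.
Proof.
apply/ffunP => j; rewrite sum_ffunE -[LHS](sum_unit_coef (fun i => u i)).
by apply: eq_bigr => i _; rewrite !ffunE [LHS]mulrC eq_sym mulrC.
Qed.

Lemma transposeE (I J : finType) (f : 'Hom(coef R J, coef R I)) v j :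
  transpose f v j = \sum_i v i * f (unit_coef R j) i.
Proof. by rewrite opE; apply: eq_bigr => i _; rewrite mulrC. Qed.

Lemma transpose_comp (I J K : finType) (f : 'Hom(coef R J, coef R I))
    (g : 'Hom(coef R K, coef R J)) :
  transpose (f \o g)%VF = (transpose g \o transpose f)%VF.
Proof.
apply/lfunP => v; apply/ffunP => k; rewrite comp_lfunE !transposeE.
under [RHS]eq_bigr => j _ do rewrite transposeE mulr_suml.
rewrite exchange_big /=; apply: eq_bigr => i _.
rewrite comp_lfunE {1}[g _]coef_sum linear_sum sum_ffunE mulr_sumr.
by apply: eq_bigr => j _; rewrite linearZ ffunE -mulrA [_ *: _]mulrC.
Qed.

End Coefficients.

(** * Point values of gathered functions, and prolongation *)

Section Transfer.
Variables (R : realType) (d : nat) (M : mesh R d) (p : nat).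
Variable x : 'I_p.+1 -> R.
Hypothesis hx : gauss_lobatto x.

Lemma node_in01 i : 0 <= x i <= 1.
Proof.
case: hx => x0 x1 mx _; rewrite -[X in X <= _ <= _]x0 -[X in _ <= _ <= X]x1.
apply/andP; split.
  by have [->//|i0] := eqVneq i ord0; apply/ltW/mx; rewrite lt0n; exact: i0.
have [->//|i1] := eqVneq i ord_max; apply/ltW/mx.
by rewrite ltn_neqAle -ltnS ltn_ord andbT; exact: i1.
Qed.

(** An end point of [0,1] is itself a node, where the only nonvanishing Lagrange polynomial is its
    own. *)
Lemma shape_support i (xi : 'rV[R]_d) :
  Defs.shape x i xi != 0 -> in_min_face xi (ref_node x i).
Proof.
move=> /prodf_neq0 nz; split; first by move=> a; rewrite mxE node_in01.
have ix := inj_nodes hx; case: hx => x0 x1 _ _.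
move=> a b e; rewrite mxE; have := nz a isT; rewrite e.
by case: b {e} => /=; [rewrite -[1%:R]x1|rewrite -[0%:R]x0];
  rewrite lagrange_node // pnatr_eq0 eqb0 negbK => /eqP ->.
Qed.

(** Single-valuedness of gathered functions: the symmetry matching the cells induces a bijection of
    local indices under which the two sums agree term by term. *)
Lemma local_fun_match l (K K' : Tmesh M l) (xi xi' : 'rV[R]_d)
    (u : Vcg M x l) :
  cube xi -> cube xi' -> Fmap K xi = Fmap K' xi' ->
  local_fun x (gather M x l u) K xi = local_fun x (gather M x l u) K' xi'.
Proof.
move=> cx cx' eF.
have [g [e [-> match_]]] :=
  face_match (@coarse_map_regular _ _ M) (@coarse_conforming _ _ M) cx cx' eF.
have ix := inj_nodes hx.
have [f fx] := choice (gauss_lobatto_sym hx).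
have f_inj : injective f.
  by move=> i j e1; apply: ix; have := congr1 x e1; rewrite !fx; lra.
pose tau b i := if b then f i else i.
have tau_inj b : injective (tau b) by case: b.
(* The action of the symmetry on nodes: permute the coordinates by [g] and reflect, through [f],
   those flagged by [e]. *)
pose phi (i : loc d p) : loc d p := [ffun a => tau (e a) (i (g a))].
have phi_inj : injective phi.
  move=> i j e1; apply/ffunP => a.
  have := congr1 (fun h : loc d p => h (g^-1 a)%g) e1.
  by rewrite !ffunE permKV => /tau_inj.
rewrite /local_fun [RHS](reindex_inj phi_inj) /=; apply: eq_bigr => i _.
have -> : Defs.shape x (phi i) (cube_sym g e xi) = Defs.shape x i xi.
  rewrite /Defs.shape [RHS](reindex_inj (@perm_inj _ g)) /=.
  apply: eq_bigr => a _.
  by rewrite mxE ffunE /tau; case: (e a); rewrite // lagrange_flip.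
(* Nodes off the minimal face of [xi] need not coincide in the two cells, but their shape functions
   vanish at [xi]. *)
have [->|nz] := eqVneq (Defs.shape x i xi) 0; first by rewrite !mulr0.
congr (_ * _).
have -> : gather M x l u (K', phi i) = gather M x l u (K, i); last by [].
rewrite !opE; apply: eq_bigr => y _; congr ((_ == _)%:R * _).
rewrite /node /= [RHS](match_ _ (shape_support nz)); congr (Fmap K' _).
by apply/rowP => a; rewrite !mxE ffunE /tau; case: (e a).
Qed.

Lemma gather_boundary l (u : Vcg M x l) Ki :
  boundary (domain M) (node x Ki) -> gather M x l u Ki = 0.
Proof.
move=> bd; rewrite opE big1 // => y _.
case: eqP => [e|_]; last by rewrite mul0r.
have := ssvalP y; rewrite mem_filter => /andP[/negP[]].
by rewrite -e inE.
Qed.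

Lemma domainE : domain M = covered (@coarse_map _ _ M).
Proof.
apply/seteqP; split => y [K _ hK].
  by exists (val K).
by exists (exist _ K isT : Tmesh M 0).
Qed.

(** Each shape function that is nonzero at [xi] belongs to a node of the minimal face, which is also
    on the boundary, where the gathered coefficient is zero. *)
Lemma local_fun_boundary l (K : Tmesh M l) (xi : 'rV[R]_d) (u : Vcg M x l) :
  cube xi -> boundary (domain M) (Fmap K xi) ->
  local_fun x (gather M x l u) K xi = 0.
Proof.
move=> cx bd; apply: big1 => i _.
have [->|nz] := eqVneq (Defs.shape x i xi) 0; first by rewrite mulr0.
have -> : gather M x l u (K, i) = 0; last by rewrite mul0r.
apply: gather_boundary; rewrite domainE in bd *.
exact: (boundary_face (@coarse_map_regular _ _ M) (@coarse_conforming _ _ M)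
  (@coarse_boundary _ _ M) cx (shape_support nz) bd).
Qed.

(** [xget] selects an arbitrary representation of the point, and all of them give the same value;
    the default 0 is never reached, since [K] and [xi] represent the point. *)
Lemma fe_funE l (K : Tmesh M l) (xi : 'rV[R]_d) (u : Vcg M x l) :
  cube xi -> fe_fun u (Fmap K xi) = local_fun x (gather M x l u) K xi.
Proof.
move=> cx; rewrite /fe_fun; case: xgetP => [r _ [K' [xi' [cx' eF ->]]]|nex].
  exact: local_fun_match.
by case: (nex (local_fun x (gather M x l u) K xi)); exists K, xi.
Qed.

(** Both sides evaluate the same finite element function at the nodes of the children: cell-wise
    through the parent polynomial, globally through the degree of freedom at the node. *)
Lemma prolong_cell_gather k (u : Vcg M x k) :
  prolong_cell M x k (gather M x k u) =
  gather M x k.+1 (prolong_cg M x k u).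
Proof.
apply/ffunP => -[K i].
have pK : present (@refined R d M) (val K).1 by case/andP: (valP K).
pose K0 : Tmesh M k := exist _ (val K).1 pK.
pose xi := child_point (val K).2 (ref_node x i).
have cxi : cube xi by apply: cube_child_point => a; rewrite mxE node_in01.
have nK : node x (K, i) = Fmap K0 xi by [].
(* The tensor product of the [prolong1] entries is the parent shape function at the child node [xi],
   and only the parent [K0] contributes. *)
have -> : prolong_cell M x k (gather M x k u) (K, i) =
    local_fun x (gather M x k u) K0 xi.
  rewrite opE (eq_bigr (fun Kj : Tmesh M k * loc d p => if Kj.1 == K0 then
    gather M x k u (Kj.1, Kj.2) * Defs.shape x Kj.2 xi else 0)); last first.
    move=> [K' j] _ /=; rewrite [K' == _]eq_sym -val_eqE /=.
    case: eqP => _; last by rewrite mul0r.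
    rewrite mulrC; congr (_ * _); apply: eq_bigr => a _.
    by rewrite /prolong1 !mxE.
  rewrite -(pair_bigA _ (fun K' j => if K' == K0 then
    gather M x k u (K', j) * Defs.shape x j xi else 0)) /=.
  rewrite (bigD1 K0) //= eqxx [X in _ + X]big1 ?addr0 // => K' /negbTE ne.
  by rewrite big1 // => j _; rewrite ne.
(* At a Dirichlet node there is no degree of freedom, so the gathered value is zero and the parent
   polynomial must vanish as well. *)
have [bd|nbd] := boolP (node x (K, i) \in boundary (domain M)).
  rewrite gather_boundary ?local_fun_boundary //; last by rewrite inE in bd.
  by rewrite -nK; rewrite inE in bd.
have Py : node x (K, i) \in
    [seq y <- [seq node x Ki | Ki : Tmesh M k.+1 * loc d p] | y \notin boundary (domain M)].
  by rewrite mem_filter nbd; apply: fintype.image_f.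
pose y : dof M x k.+1 := SeqSub Py.
rewrite opE (bigD1 y) //= eqxx mul1r [X in _ + X]big1 ?addr0; last first.
  move=> z zy; case: eqP => [e|]; last by rewrite mul0r.
  by rewrite -val_eqE /= e eqxx in zy.
rewrite opE /= nK; apply: esym.
under eq_bigr => z _ do rewrite fe_funE //.
rewrite [u in RHS]coef_sum linear_sum /local_fun.
under [RHS]eq_bigr => j _ do rewrite sum_ffunE mulr_suml.
rewrite [RHS]exchange_big /=; apply: eq_bigr => z _; rewrite mulr_suml.
by apply: eq_bigr => j _; rewrite linearZ ffunE [LHS]mulrC mulrA.
Qed.

Lemma transpose_gather_restrict k (r : Vcell M p k.+1) :
  transpose (gather M x k) (restrict_cell M x k r) =
  restrict_cg M x k (transpose (gather M x k.+1) r).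
Proof.
rewrite -!comp_lfunE -!transpose_comp; congr (transpose _ r).
by apply/lfunP => u; rewrite !comp_lfunE prolong_cell_gather.
Qed.

(** Every degree of freedom is a node of some cell, so its coefficient can be read off from a local
    copy. *)
Lemma lker0_gather l : lker (gather M x l) == 0%VS.
Proof.
apply/lker0P => u v e; apply/ffunP => y.
have := ssvalP y; rewrite mem_filter => /andP[_ /fintype.imageP[Ki _ eK]].
have h w : gather M x l w Ki = w y.
  rewrite opE (bigD1 y) // -eK eqxx mul1r big1 => [|z /negbTE zy]; first exact: addr0.
  by rewrite (inj_eq (@val_inj _ _ (dof M x l))) eq_sym zy mul0r.
by rewrite -!h e.
Qed.

End Transfer.

(** * V-cycles and iteration matrices *)

Section AffineFamilies.
Variables (R : realType) (I : Type).

(* The linear parts do not depend on the index [i], which ranges over the stored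
   right-hand sides. *)
Definition affine_family (V U W : vectType R) (h : I -> V -> U -> W) : Prop :=
  exists (m : 'Hom(U, W)) (n : 'Hom(V, W)) (c : I -> W),
    forall i b u, h i b u = m u + n b + c i.

Section Closure.
Variables V U W : vectType R.

Lemma affine_fst : affine_family (fun _ (b : V) (_ : U) => b).
Proof.
by exists 0, \1%VF, (fun=> 0) => i b u; rewrite zero_lfunE id_lfunE add0r addr0.
Qed.

Lemma affine_snd : affine_family (fun _ (_ : V) (u : U) => u).
Proof.
by exists \1%VF, 0, (fun=> 0) => i b u; rewrite zero_lfunE id_lfunE !addr0.
Qed.

Lemma affine_const (c : I -> W) : affine_family (fun i (_ : V) (_ : U) => c i).
Proof. by exists 0, 0, c => i b u; rewrite !zero_lfunE !add0r. Qed.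

Lemma affine_add (h h' : I -> V -> U -> W) :
  affine_family h -> affine_family h' ->
  affine_family (fun i b u => h i b u + h' i b u).
Proof.
move=> [m [n [c hE]]] [m' [n' [c' hE']]].
exists (m + m'), (n + n'), (fun i => c i + c' i) => i b u.
by rewrite hE hE' !add_lfunE addrACA; congr (_ + _); rewrite addrACA.
Qed.

End Closure.

Lemma affine_linear (V U W W' : vectType R) (f : 'Hom(W, W')) (h : I -> V -> U -> W) :
  affine_family h -> affine_family (fun i b u => f (h i b u)).
Proof.
move=> [m [n [c hE]]]; exists (f \o m)%VF, (f \o n)%VF, (fun i => f (c i)).
by move=> i b u; rewrite hE !linearD !comp_lfunE.
Qed.

Lemma affine_comp (V U W V' U' : vectType R) (f : I -> V' -> U' -> W)
    (h : I -> V -> U -> V') (h' : I -> V -> U -> U') :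
  affine_family f -> affine_family h -> affine_family h' ->
  affine_family (fun i b u => f i (h i b u) (h' i b u)).
Proof.
move=> [m [n [c fE]]] ah ah'.
have [m' [n' [c' hE]]] := affine_add (affine_add (affine_linear m ah')
  (affine_linear n ah)) (affine_const _ _ c).
by exists m', n', c' => i b u; rewrite fE -hE.
Qed.

Lemma affine_iter (V U : vectType R) (f : I -> V -> U -> U) k :
  affine_family f -> affine_family (fun i b u => iter k (f i b) u).
Proof.
move=> af; elim: k => [|k IHk]; first exact: affine_snd.
exact: affine_comp af (affine_fst _ _) IHk.
Qed.

End AffineFamilies.

(** * Affinity and intertwining of abstract V-cycles *)

Section VCycles.
Variables (R : realType) (V : nat -> vectType R).
Variables (A : forall k, 'End(V k)) (coarse_solve : 'End(V 0)).
Variable S : forall k, 'End(V k) -> V k -> V k -> V k.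
Variables (Res : forall k, 'Hom(V k.+1, V k)).
Variables (Pro : forall k, 'Hom(V k, V k.+1)).
Variables (nu1 nu2 : nat).

(** Each step is affine in the right-hand side and the iterate, and the stored right-hand sides
    enter only the constant term. The linear part may thus be computed at any convenient right-hand
    sides. *)
Lemma vcycle_affine l :
  (forall k, (0 < k <= l)%N -> jointly_affine (S (A k))) ->
  affine_family (fun bs (b u : V l) =>
    vcycle A coarse_solve S Res Pro nu1 nu2 bs (fun=> 0) b u).
Proof.
elim: l => [_|l IHl affS] /=.
  exact: affine_linear (affine_fst _ _ _).
have [m [n [c SE]]] := affS l.+1 (ltnSn l).
have affSl : affine_family (fun _ : forall k, V k => S (A l.+1)).
  by exists m, n, (fun=> c).
have {}IHl : affine_family (fun bs (b u : V l) =>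
    vcycle A coarse_solve S Res Pro nu1 nu2 bs (fun=> 0) b u).
  by apply: IHl => k /andP[k0 kl]; apply: affS; rewrite k0 ltnW.
have aff1 := affine_iter nu1 affSl.
apply: (affine_comp (affine_iter nu2 affSl) (affine_fst _ _ _)).
apply: affine_add => //; apply: affine_linear.
apply: (affine_comp IHl); last exact: affine_const.
apply: affine_add.
  exact: (affine_const _ _ (fun bs : forall k, V k => bs l)).
apply: affine_linear; apply: affine_add; first exact: affine_fst.
(* The residual is treated as a sum, with [- A l.+1] applied to the smoothed iterate. *)
have := affine_linear (- A l.+1) aff1.
by move=> [m' [n' [c' hE]]]; exists m', n', c' => i b u; rewrite -hE opp_lfunE.
Qed.

Variables (W : nat -> vectType R) (G : forall k, 'Hom(W k, V k)).
Variables (T : forall k, 'Hom(V k, W k)) (coarse_solve' : 'End(W 0)).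
Variable S' : forall k, 'End(W k) -> W k -> W k -> W k.
Variables (Res' : forall k, 'Hom(W k.+1, W k)).
Variables (Pro' : forall k, 'Hom(W k, W k.+1)).
Let A' k : 'End(W k) := (T k \o A k \o G k)%VF.

(** [G] plays the role of gathering and [T] of assembly. Iterates correspond through [G] and
    right-hand sides through [T], and each step preserves this correspondence. *)
Lemma vcycle_intertwine l :
  coarse_solve = (G 0 \o coarse_solve' \o T 0)%VF ->
  (forall k, (0 < k <= l)%N -> forall b u,
    S (A k) b (G k u) = G k (S' (A' k) (T k b) u)) ->
  (forall k, (k < l)%N -> forall u, Pro k (G k u) = G k.+1 (Pro' k u)) ->
  (forall k, (k < l)%N -> forall r, T k (Res k r) = Res' k (T k.+1 r)) ->
  forall (bs : forall k, V k) b u,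
  vcycle A coarse_solve S Res Pro nu1 nu2 bs (fun=> 0) b (G l u) =
  G l (vcycle A' coarse_solve' S' Res' Pro' nu1 nu2 (fun k => T k (bs k))
         (fun=> 0) (T l b) u).
Proof.
move=> coarseE; elim: l => [_ _ _ bs b u|l IHl SE ProE ResE bs b u] /=.
  by rewrite coarseE !comp_lfunE.
have iterE k v : iter k (S (A l.+1) b) (G l.+1 v) =
    G l.+1 (iter k (S' (A' l.+1) (T l.+1 b)) v).
  by elim: k => //= k ->; rewrite SE ?ltnSn.
rewrite iterE; set u1 := iter nu1 _ u.
(* The zero initial iterate of the lower level is the image of zero under [G l], which brings the
   recursive call into the form of the induction hypothesis. *)
rewrite -[X in vcycle _ _ _ _ _ _ _ _ _ _ X](linear0 (G l)) IHl; last 3 first.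
- by move=> k /andP[k0 kl]; apply: SE; rewrite k0 ltnW.
- by move=> k kl; apply: ProE; rewrite ltnW.
- by move=> k kl; apply: ResE; rewrite ltnW.
rewrite ProE // -linearD iterE.
(* What remains is that [T l] maps the updated lower-level right-hand side to its counterpart. *)
congr (G _ (iter _ _ (_ + Pro' _ (vcycle _ _ _ _ _ _ _ _ _ _ _)))).
by rewrite [LHS]linearD /= ResE // [T l.+1 (_ - _)]linearB !comp_lfunE.
Qed.

End VCycles.

(** * Similar endomorphisms and their spectra *)

Section Similarity.
Variable R : realType.

(** The sizes are separate variables because the dimensions of two isomorphic spaces are not
    convertible; the two-sided inverse forces them to be equal. *)
Lemma char_poly_similar m n (A : 'M[R]_m) (B : 'M[R]_n) (P : 'M[R]_(m, n))
    (Q : 'M[R]_(n, m)) :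
  P *m Q = 1%:M -> Q *m P = 1%:M -> B = Q *m A *m P ->
  char_poly A = char_poly B.
Proof.
move=> PQ QP; have emn : m = n.
  by apply/eqP; rewrite eqn_leq (mulmx1_min PQ) (mulmx1_min QP).
case: n / emn B P Q PQ QP => B P Q PQ QP ->; rewrite /char_poly.
have QP' : map_mx polyC Q *m map_mx polyC P = 1%:M.
  by rewrite -map_mxM QP map_mx1.
have -> : char_poly_mx (Q *m A *m P) =
    map_mx polyC Q *m char_poly_mx A *m map_mx polyC P.
  rewrite /char_poly_mx mulmxBr mulmxBl !map_mxM /= mul_mx_scalar -scalemxAl.
  by rewrite QP' scalemx1.
by rewrite !det_mulmx mulrAC -det_mulmx QP' det1 mul1r.
Qed.

Variables U V : vectType R.

Lemma spectrum_similar (g : 'Hom(U, V)) (f1 : 'End(U)) (f2 : 'End(V)) :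
  similar_via g f1 f2 -> spectrum f2 = spectrum f1.
Proof.
move=> [kg ig ->]; rewrite /spectrum.
have gK : (g^-1 \o g)%VF = \1%VF := lker0_compVf kg.
have Kg : (g \o g^-1)%VF = \1%VF.
  by apply/lfunP => v; rewrite comp_lfunE id_lfunE limg_lfunVK // (eqP ig) memvf.
have bU := vbasisP {:U}; have bV := vbasisP {:V}.
suff -> : char_poly (passmx.mxof (vbasis {:V}) (vbasis {:V})
      (g \o f1 \o g^-1)%VF) =
    char_poly (passmx.mxof (vbasis {:U}) (vbasis {:U}) f1) by [].
apply/esym/(char_poly_similar (P := passmx.mxof (vbasis {:U}) (vbasis {:V}) g)
  (Q := passmx.mxof (vbasis {:V}) (vbasis {:U}) g^-1)).
- by rewrite -(passmx.mxof_comp _ _ bV) gK passmx.mxof1 // (basis_free bU).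
- by rewrite -(passmx.mxof_comp _ _ bU) Kg passmx.mxof1 // (basis_free bV).
- by rewrite !(passmx.mxof_comp _ _ bU) mulmxA.
Qed.

Lemma iteration_affine (f : V -> V) (m : 'End(V)) (c : V) :
  (forall u, f u = m u + c) -> iteration f = m.
Proof.
move=> fE; rewrite /iteration (_ : (fun u => f u - f 0) = m).
  by apply/lfunP => u; rewrite lfunE.
by apply/funext => u; rewrite !fE linear0 add0r addrK.
Qed.

Variables (G : 'Hom(U, V)) (E' : 'End(U)) (E : 'End(V)).
Hypothesis G_inj : lker G == 0%VS.
Hypothesis EG : forall u, E (G u) = G (E' u).

Lemma limg_stable : (E @: limg G <= limg G)%VS.
Proof.
have -> : (E @: limg G = G @: limg E')%VS.
  rewrite -!limg_comp; congr (_ @: _)%VS.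
  by apply/lfunP => u; rewrite !comp_lfunE.
by rewrite limgS // subvf.
Qed.

Lemma vsval_corestriction u : vsval (corestriction G u) = G u.
Proof. by rewrite lfunE /= vsprojK // memv_img // memvf. Qed.

(** Every vector of the image has the form [corestriction G u], and on such vectors conjugating [E']
    agrees with [E] by [EG]. *)
Lemma similar_restriction :
  similar_via (corestriction G) E' (restriction (limg G) E).
Proof.
have kg : lker (corestriction G) == 0%VS.
  apply/lker0P => u v /(congr1 vsval); rewrite !vsval_corestriction.
  exact/lker0P.
have surj w : exists u, w = corestriction G u.
  have /memv_imgP[u _ e] := subvsP w.
  by exists u; apply: val_inj; rewrite /= vsval_corestriction.
split=> //.
  apply/eqP/vspaceP => w; rewrite memvf; have [u ->] := surj w.
  by rewrite memv_img // memvf.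
apply/lfunP => w; have [u ->] := surj w.
rewrite !comp_lfunE lker0_lfunK //; apply: val_inj.
rewrite lfunE /= !vsval_corestriction EG vsprojK //.
by rewrite memv_img // memvf.
Qed.

End Similarity.

(** * Transport of norms along a similarity *)

Section NormTransport.
Variables (R : realType) (U V : vectType R) (g : 'Hom(U, V)).
Variables (f1 : 'End(U)) (f2 : 'End(V)) (N : U -> R).
Hypothesis sim : similar_via g f1 f2.

Lemma is_norm_transport : is_norm N -> is_norm (fun w => N (g^-1%VF w)).
Proof.
case: sim => kg /eqP ig _ [N0 NZ ND]; split.
- move=> v /N0 e; rewrite -(@limg_lfunVK _ _ _ g v) ?ig ?memvf //.
  by rewrite e linear0.
- by move=> c v; rewrite linearZ NZ.
- by move=> v w; rewrite linearD ND.
Qed.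

Lemma norm_bound_transport n rho :
  norm_bound N f1 n rho -> norm_bound (fun w => N (g^-1%VF w)) f2 n rho.
Proof.
case: sim => kg _ -> h w.
(* Inner factors of [g] and its inverse cancel, so powers of the conjugate are conjugates of
   powers. *)
suff -> : g^-1%VF (iter n (g \o f1 \o g^-1)%VF w) = iter n f1 (g^-1%VF w) by [].
by elim: n {h} => //= n IHn; rewrite !comp_lfunE lker0_lfunK // IHn.
Qed.

End NormTransport.

Unset Implicit Arguments.
Set Strict Implicit.
Set Printing Implicit Defensive.

Theorem theorem2 (R : realType) (d p nu1 nu2 : nat)
  (M : mesh R d) (x : 'I_p.+1 -> R) (a : elliptic_form (domain M))
  (S : forall k, 'End(Vcell M p k) -> Vcell M p k -> Vcell M p k -> Vcell M p k)
  (Scg : forall k, 'End(Vcg M x k) -> Vcg M x k -> Vcg M x k -> Vcg M x k)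
  (CHN : forall k, 'End(Vcg M x k))
  (hd : d = 2%N \/ d = 3%N)
  (hp : (0 < p)%N)
  (hx : gauss_lobatto x)
  (hA0 : lker (Acg x a 0) == 0%VS)
  (hE : forall k, (0 < k <= finest M)%N -> forall b u y,
    refinement_edge y -> Scg k (Acg x a k) b u y = u y)
  (hS : forall k, (0 < k <= finest M)%N ->
    forall (u : Vcg M x k) (bt : Vcell M p k),
    S k (Acell x a k) bt (gather M x k u) =
    gather M x k (Scg k (Acg x a k) (transpose (gather M x k) bt) u))
  (hC : forall k, (k < finest M)%N -> forall v : Vcg M x k,
    CHN k.+1 (prolong_cg M x k v) = prolong_cg M x k v) :
  (forall l, (l <= finest M)%N ->
    forall (u : Vcg M x l) (bt : Vcell M p l) (bs : forall k, Vcell M p k),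
    mg_local x a nu1 nu2 S bs bt (gather M x l u) =
    gather M x l (mg_local_cg a nu1 nu2 Scg CHN
      (fun k => transpose (gather M x k) (bs k))
      (transpose (gather M x l) bt) u))
  /\
  ((forall k, (0 < k <= finest M)%N ->
      jointly_affine (S k (Acell x a k)) /\
      jointly_affine (Scg k (Acg x a k))) ->
   forall l, (l <= finest M)%N ->
   forall (bt : Vcell M p l) (bs : forall k, Vcell M p k)
          (b : Vcg M x l) (bs' : forall k, Vcg M x k),
   let f := mg_local x a nu1 nu2 S bs bt in
   let f' := mg_local_cg a nu1 nu2 Scg CHN bs' b in
   let E := iteration f in
   let E' := iteration f' in
   let W := limg (gather M x l) in
   let EW := restriction W E in
   let g := corestriction (gather M x l) in
   [/\ (forall w, f w = E w + f 0) /\ (forall u, f' u = E' u + f' 0),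
       (E @: W <= W)%VS,
       similar_via g E' EW,
       spectrum EW = spectrum E' /\
         (forall rho, spectral_bound E' rho -> spectral_bound EW rho)
     & forall N : Vcg M x l -> R, is_norm N ->
         let NW := fun w => N ((g^-1)%VF w) in
         is_norm NW /\
         (forall n rho, norm_bound N E' n rho -> norm_bound NW EW n rho)]).
Proof.
have cg_restrict k : (k < finest M)%N ->
    (restrict_cg M x k \o transpose (CHN k.+1))%VF = restrict_cg M x k.
  move=> kl; rewrite -transpose_comp; congr (transpose _).
  by apply/lfunP => v; rewrite comp_lfunE hC.
have intertwine l : (l <= finest M)%N ->
    forall (u : Vcg M x l) (bt : Vcell M p l) (bs : forall k, Vcell M p k),
    mg_local x a nu1 nu2 S bs bt (gather M x l u) =
    gather M x l (mg_local_cg a nu1 nu2 Scg CHN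
      (fun k => transpose (gather M x k) (bs k))
      (transpose (gather M x l) bt) u).
  move=> ll u bt bs.
  apply: (@vcycle_intertwine _ (Vcell M p) (Acell x a) _ _ _ _ _ _ (Vcg M x)
    (gather M x) (fun k => transpose (gather M x k))).
  - by rewrite /coarse_cell.
  - by move=> k /andP[k0 kl] b v; apply: hS; rewrite k0 (leq_trans kl).
  - by move=> k kl v; apply: prolong_cell_gather.
  - move=> k kl r; rewrite cg_restrict ?(leq_trans kl) //.
    exact: transpose_gather_restrict.
split=> // aff l ll bt bs b bs'.
(* The linear part [m] is obtained before any right-hand side is fixed, so it serves all of them. *)
have [m [n [c fE]]] : affine_family (mg_local x a nu1 nu2 S ^~ l).
  apply: vcycle_affine => k /andP[k0 kl].
  by apply: (aff k _).1; rewrite k0 (leq_trans kl).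
have [m' [n' [c' fE']]] : affine_family (mg_local_cg a nu1 nu2 Scg CHN ^~ l).
  apply: vcycle_affine => k /andP[k0 kl].
  by apply: (aff k _).2; rewrite k0 (leq_trans kl).
move=> f f' E E' W EW g.
have {}fEb u : f u = m u + (n bt + c bs) by rewrite addrA; apply: fE.
have {}fEb' u : f' u = m' u + (n' b + c' bs') by rewrite addrA; apply: fE'.
have EE : E = m := iteration_affine fEb.
have EE' : E' = m' := iteration_affine fEb'.
(* The right-hand sides of [f] and [f'] are unrelated here. The cycles are therefore compared at
   zero right-hand sides, and the constant terms are cancelled using the case [u = 0]. *)
have EG u : E (gather M x l u) = gather M x l (E' u).
  rewrite EE EE'; have h v := intertwine l ll v 0 (fun=> 0).
  have {}h v : m (gather M x l v) + (n 0 + c (fun=> 0)) =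
      gather M x l (m' v) + gather M x l
        (n' (transpose (gather M x l) 0) +
         c' (fun k => transpose (gather M x k) 0)).
    by rewrite -linearD !addrA -fE -fE'; apply: h.
  have := h 0; rewrite (linear0 (gather M x l)) (linear0 m) (linear0 m') (linear0 (gather M x l)) !add0r.
  by have := h u => + h0; rewrite -h0 => /addIr.
have sim : similar_via g E' EW by apply: similar_restriction; rewrite ?lker0_gather.
have sp := spectrum_similar sim.
split=> //.
- split=> [w|u]; first by rewrite !fEb linear0 add0r EE.
  by rewrite !fEb' linear0 add0r EE'.
- exact: (limg_stable EG).
- by split=> // rho; rewrite /spectral_bound sp.
- move=> N nN; split; first exact: (is_norm_transport sim nN).
  exact: (norm_bound_transport sim).
Qed.
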